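(* Consider the sigmoid-gated mixture-of-experts regression model described in the context, with $k>k_*$ fitted experts and the least squares estimator $\widehat{G}_n$, under assumptions (A.1)–(A.3). Assume Regime 1, i.e. every true gating parameter $\beta^*_{1j}$ whose true atom is over-specified (approximated by at least two fitted atoms of $\widehat{G}_n$) equals $0_d$. Then $$\|f_{\widehat{G}_n}-f_{G_*}\|_{L_2(\mu)}=\mathcal{O}_P\big([\log(n)/n]^{1/2}\big).$$
   Context: Data $(X_1,Y_1),\dots,(X_n,Y_n)\in\mathbb{R}^d\times\mathbb{R}$ satisfy $Y_i=f_{G_*}(X_i)+\epsilon_i$, where $X_1,\dots,X_n$ are i.i.d. from a probability distribution $\mu$ on $\mathbb{R}^d$ and $\epsilon_1,\dots,\epsilon_n$ are independent Gaussian noise variables with $\mathbb{E}[\epsilon_i\mid X_i]=0$, $\mathrm{Var}(\epsilon_i\mid X_i)=\nu$. Let $\sigma(x,\beta_1,\beta_0):=1/(1+\exp(-\beta_1^\top x-\beta_0))$ and let $x\mapsto h(x,\eta)$, $\eta\in\mathbb{R}^q$, be a parametric expert function. For parameters $(\beta_{0i},\beta_{1i},\eta_i)_{i=1}^{k'}\subset\mathbb{R}\times\mathbb{R}^d\times\mathbb{R}^q$, the mixing measure is $G=\sum_{i=1}^{k'}\frac{1}{1+\exp(-\beta_{0i})}\delta_{(\beta_{1i},\eta_i)}$ and $f_G(x)=\sum_{i=1}^{k'}\sigma(x,\beta_{1i},\beta_{0i})h(x,\eta_i)$. The true mixing measure $G_*$ has $k_*$ atoms with parameters $(\beta^*_{0i},\beta^*_{1i},\eta^*_i)_{i=1}^{k_*}$.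 For a parameter set $\Theta\subseteq\mathbb{R}\times\mathbb{R}^d\times\mathbb{R}^q$, $\mathcal{G}_k(\Theta)$ is the set of such mixing measures with $1\le k'\le k$ atoms and all $(\beta_{0i},\beta_{1i},\eta_i)\in\Theta$. The least squares estimator is $\widehat{G}_n\in\arg\min_{G\in\mathcal{G}_k(\Theta)}\sum_{i=1}^n(Y_i-f_G(X_i))^2$, with $k>k_*$. Assumptions: (A.1) $\Theta$ is compact and the input space $\mathcal{X}\subseteq\mathbb{R}^d$ is bounded; (A.2) $h(x,\eta)$ is Lipschitz in $\eta$ and bounded, $\mu$-a.s.; (A.3) $\eta^*_1,\dots,\eta^*_{k_*}$ are pairwise distinct. Writing $\omega_i=(\beta_{1i},\eta_i)$, $\omega^*_j=(\beta^*_{1j},\eta^*_j)$, the Voronoi cell of a mixing measure $G$ is $\mathcal{A}_j(G)=\{i:\|\omega_i-\omega^*_j\|\le\|\omega_i-\omega^*_\ell\|\ \forall\ell\neq j\}$; a true index $j$ (and its parameter $\beta^*_{1j}$) is called over-specified if its atom is fitted by at least two atoms of the estimator. $\mathcal{O}_P(b_n)$ denotes a quantity whose ratio to $b_n$ is stochastically bounded. *)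

(* Defs.v *)
From HB Require Import structures.
From mathcomp Require Import all_boot all_order all_algebra all_classical all_reals all_analysis.
Import Order.TTheory GRing.Theory Num.Theory numFieldTopology.Exports numFieldNormedType.Exports.
Set Implicit Arguments.
Unset Strict Implicit.
Unset Printing Implicit Defensive.
Local Open Scope classical_set_scope.
Local Open Scope ring_scope.

Definition Rd (R : realType) (d : nat) := g_sigma_algebraType (@open 'rV[R]_d).

(* A parameter triple (beta0, (beta1, eta)) in R x R^d x R^q. *)
Definition atom (R : realType) (d q : nat) := (R * ('rV[R]_d * 'rV[R]_q))%type.

Definition sigmoid (R : realType) (d : nat) (x : 'rV[R]_d) (beta1 : 'rV[R]_d) (beta0 : R) : R :=
  1 / (1 + expR (- (\sum_(i < d) beta1 0 i * x 0 i) - beta0)).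

Definition regfun (R : realType) (d q : nat) (h : 'rV[R]_d -> 'rV[R]_q -> R)
    (G : seq (atom R d q)) (x : 'rV[R]_d) : R :=
  \sum_(a <- G) sigmoid x a.2.1 a.1 * h x a.2.2.

Definition in_Gk (R : realType) (d q : nat) (Theta : set (atom R d q)) (k : nat)
    (G : seq (atom R d q)) : Prop :=
  (0 < size G <= k)%N /\ (forall a, a \in G -> Theta a).

Definition sqdist (R : realType) (d q : nat) (w w' : 'rV[R]_d * 'rV[R]_q) : R :=
  \sum_(i < d) (w.1 0 i - w'.1 0 i) ^+ 2 + \sum_(i < q) (w.2 0 i - w'.2 0 i) ^+ 2.

Definition atom0 (R : realType) (d q : nat) : atom R d q := (0, (0, 0)).

Definition voronoi_card (R : realType) (d q : nat) (Gs G : seq (atom R d q))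
    (j : 'I_(size Gs)) : nat :=
  count (fun a : atom R d q =>
     [forall l : 'I_(size Gs), (l != j) ==>
        (sqdist a.2 (nth (atom0 R d q) Gs j).2 <= sqdist a.2 (nth (atom0 R d q) Gs l).2)]) G.

Definition regression_design (R : realType) (d : nat) (dO : measure_display)
    (Omega : measurableType dO) (P : probability Omega R) (mu : probability (Rd R d) R)
    (nu : R) (X : nat -> Omega -> Rd R d) (eps : nat -> Omega -> R) : Prop :=
  [/\ (forall i, measurable_fun [set: Omega] (X i)),
      (forall i, measurable_fun [set: Omega] (eps i)),
      (forall i (A : set (Rd R d)), measurable A -> P (X i @^-1` A) = mu A),
      (forall i (B : set R), measurable B ->
          P (eps i @^-1` B) = normal_prob 0 (Num.sqrt nu) B) &
      (forall (n : nat) (A : nat -> set (Rd R d)) (B : nat -> set R),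
          (forall i, measurable (A i)) -> (forall i, measurable (B i)) ->
          P (\bigcap_(i in [set j : nat | (j < n)%N]) (X i @^-1` A i `&` eps i @^-1` B i))
          = (\prod_(i < n) (P (X i @^-1` A i) * P (eps i @^-1` B i)))%E)].
Arguments voronoi_card {R d q} Gs G j.

(* Main.v *)
Require Import Defs.
From HB Require Import structures.
From mathcomp Require Import all_boot all_order all_algebra all_classical all_reals all_analysis.
From mathcomp Require Import measurable_realfun ring lra.
Import Order.TTheory GRing.Theory Num.Theory numFieldTopology.Exports numFieldNormedType.Exports.
Set Implicit Arguments.
Unset Strict Implicit.
Unset Printing Implicit Defensive.
Local Open Scope classical_set_scope.
Local Open Scope ring_scope.

(** Since [G_*] itself belongs to [G_k(Theta)], the least squares property gives,
for [f = f_{Ghat_n} - f_{G_*}], the basic inequality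
[sum f(X_i)^2 <= 2 sum eps_i f(X_i)]. For a fixed [g] bounded by [K], integrating
[exp (- (g(X)^2 - 2 eps g(X)) / (4 nu))] first over the Gaussian noise and then over [X]
gives at most [exp (- ||g||^2 / (8 nu + K^2))], so that by independence and Markov's
inequality [sum (g(X_i)^2 - 2 eps_i g(X_i))] is at most [t] with probability at most
[exp (t / (4 nu) - n ||g||^2 / (8 nu + K^2))]. The regression functions have a sup-norm net
of mesh [1/n] with polynomially many elements (the net need not stay inside [Theta]), and
moving to the net perturbs the sum by a bounded amount once [sum |eps_i| <= n C]. A union
bound over the elements of the net with [||g||^2] at least a large multiple of [log n / n]
concludes. *)

(** * Change of variables for weighted image measures *)

Section transport.
Context d1 d2 (T1 : measurableType d1) (T2 : measurableType d2) (R : realType).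
Local Open Scope ereal_scope.
Variables (mu : {measure set T1 -> \bar R}) (V : T1 -> T2) (W : T1 -> R).
Hypotheses (mV : measurable_fun setT V) (mW : measurable_fun setT W).
Hypothesis W0 : forall x, (0 <= W x)%R.
Import HBNNSimple.

(** By monotone convergence along simple approximations of [f], only indicators matter, and for them
    the identity is the hypothesis on [nu]. It serves both for laws of random variables ([W = 1])
    and for measures with density [W] ([V] the identity). *)
Lemma ge0_integral_transport (nu : {measure set T2 -> \bar R}) (f : T2 -> \bar R) :
  (forall A, measurable A -> nu A = \int[mu]_(x in V @^-1` A) (W x)%:E) ->
  measurable_fun setT f -> (forall y, 0 <= f y) ->
  \int[nu]_y f y = \int[mu]_x (f (V x) * (W x)%:E).
Proof.
move=> nuE mf f0.
pose h := nnsfun_approx measurableT mf.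
have mEW : measurable_fun setT (fun x => (W x)%:E) by exact/measurable_EFinP.
have mVA A : measurable A -> measurable (V @^-1` A).
  by move=> mA; rewrite -[X in measurable X]setTI; exact: mV.
have -> : \int[nu]_y f y = limn (fun n => \int[nu]_y (h n y)%:E).
  rewrite -monotone_convergence//.
  - by apply: eq_integral => y _; apply/esym/cvg_lim => //; exact: cvg_nnsfun_approx.
  - by move=> n; exact/measurable_EFinP/measurable_funP.
  - by move=> n y _; rewrite lee_fin.
  - by move=> y _ a b ab; rewrite lee_fin; exact/lefP/nd_nnsfun_approx.
have -> : \int[mu]_x (f (V x) * (W x)%:E) =
    limn (fun n => \int[mu]_x ((h n (V x))%:E * (W x)%:E)).
  rewrite -monotone_convergence//.
  - apply: eq_integral => y _; apply/esym/cvg_lim => //.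
    by apply: cvgeZr => //; exact: cvg_nnsfun_approx.
  - move=> n; apply: emeasurable_funM => //; apply/measurable_EFinP.
    exact: measurableT_comp.
  - by move=> n y _; rewrite mule_ge0 ?lee_fin.
  - move=> y _ a b ab; rewrite lee_wpmul2r ?lee_fin//; exact/lefP/nd_nnsfun_approx.
congr (limn _); apply/funext => n.
have hI r y : 0 <= (r * \1_(h n @^-1` [set r]) y)%:E.
  by rewrite EFinM; exact: nnfun_muleindic_ge0.
transitivity (\int[nu]_y
   (\sum_(r \in range (h n)) (r * \1_(h n @^-1` [set r]) y)%:E)).
  by apply: eq_integral => t tE; rewrite /= fsumEFin// -fimfunE.
rewrite ge0_integral_fsum//; last first.
  by move=> r; apply/measurable_EFinP; exact: measurable_funM.
transitivity (\int[mu]_x (\sum_(r \in range (h n))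
  (r * \1_(h n @^-1` [set r]) (V x))%:E * (W x)%:E)); last first.
  apply: eq_integral => x _.
  rewrite -ge0_mule_fsuml => [|y]; last exact: hI.
  by rewrite fsumEFin // -(fimfunE _ (V x)).
have mi r : measurable_fun [set: T1] (fun x => (\1_(h n @^-1` [set r]) (V x))%:E : \bar R).
  by apply/measurable_EFinP; apply: measurableT_comp.
rewrite ge0_integral_fsum//; last 2 first.
- move=> y; apply: emeasurable_funM => //; under eq_fun do rewrite EFinM.
  exact: measurable_funeM.
- by move=> m y Ey; rewrite mule_ge0 ?lee_fin// -lee_fin.
apply: eq_fsbigr => r /set_mem -[t _ <-].
under eq_integral do rewrite EFinM.
under [RHS]eq_integral do rewrite EFinM -muleA.
rewrite ge0_integralZl ?lee_fin//; first last.
  exact/measurable_EFinP.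
rewrite [RHS]ge0_integralZl ?lee_fin//; first last.
- by move=> x _; rewrite mule_ge0 ?lee_fin.
- exact: emeasurable_funM.
rewrite integral_indic// setIT nuE//; congr (_ * _).
rewrite integral_mkcond; apply: eq_integral => x _.
rewrite epatch_indic /= muleC; congr (_ * _).
Qed.

(** The image under [V] of the measure with density [W]. It stays a bare set function here; the
    lemmas below supply what is needed to pack it as a measure. *)
Definition weighted_image (A : set T2) := \int[mu]_(x in V @^-1` A) (W x)%:E.

Let mVA A : measurable A -> measurable (V @^-1` A).
Proof. by move=> mA; rewrite -[X in measurable X]setTI; exact: mV. Qed.

Lemma weighted_image0 : weighted_image set0 = 0.
Proof. by rewrite /weighted_image preimage_set0 integral_set0. Qed.

Lemma weighted_image_ge0 A : 0 <= weighted_image A.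
Proof. by apply: integral_ge0 => x _; rewrite lee_fin. Qed.

Lemma weighted_image_sigma_additive : semi_sigma_additive weighted_image.
Proof.
move=> F mF tF mUF; rewrite /weighted_image preimage_bigcup.
rewrite ge0_integral_bigcup//=.
- apply: is_cvg_ereal_nneg_natsum_cond => n _ _.
  exact: weighted_image_ge0.
- by move=> k; exact: mVA.
- by apply/measurable_funTS/measurable_EFinP.
- by move=> x _; rewrite lee_fin.
- apply/trivIsetP => i j _ _ ij; rewrite -preimage_setI.
  by move/trivIsetP : tF => /(_ _ _ _ _ ij) ->//; rewrite preimage_set0.
Qed.

End transport.

(** * Expectations of products over independent pairs *)

Section independent_pairs.
Context d0 d1 d2 (Omega : measurableType d0) (T1 : measurableType d1)
  (T2 : measurableType d2) (R : realType).
Local Open Scope ereal_scope.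
Variables (P : {measure set Omega -> \bar R}) (m1 : probability T1 R)
  (m2 : probability T2 R).

(** Uniqueness of the product measure extends the identity from rectangles to all measurable sets.
    The constant [c] is absorbed in the first factor as [m1c], so that the limit measure is again a
    product. *)
Lemma integral_weighted_product (V : Omega -> T1 * T2) (W : Omega -> R) (c : R)
    (f : T1 * T2 -> \bar R) :
  measurable_fun setT V -> measurable_fun setT W ->
  (forall x, (0 <= W x)%R) -> (0 <= c)%R ->
  (forall A B, measurable A -> measurable B ->
    \int[P]_(x in V @^-1` (A `*` B)) (W x)%:E = c%:E * (m1 A * m2 B)) ->
  measurable_fun setT f -> (forall y, 0 <= f y) ->
  \int[P]_x (f (V x) * (W x)%:E) = c%:E * \int[m1 \x m2]_y f y.
Proof.
move=> mV mW W0 c0 PE mf f0.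
pose m' : {measure set (T1 * T2) -> \bar R} := HB.pack (weighted_image P V W)
  (isMeasure.Build _ _ _ (weighted_image P V W) (weighted_image0 P V W)
    (weighted_image_ge0 P V W0) (weighted_image_sigma_additive (mu := P) mV mW W0)).
pose m1c : {finite_measure set T1 -> \bar R} := mscale (NngNum c0) m1.
have m'E A : measurable A -> (m1c \x m2) A = \int[P]_(x in V @^-1` A) (W x)%:E.
  move=> mA; rewrite (@product_measure_unique _ _ _ _ _ m1c m2 m')//.
  by move=> A1 B1 mA1 mB1; rewrite /= /weighted_image PE//= /mscale/= muleA.
rewrite -(ge0_integral_transport mV mW W0 m'E mf f0).
rewrite !fubini_tonelli1//= ge0_integral_mscale//.
- exact: measurable_fun_fubini_tonelli_F.
- by move=> x _; exact: integral_ge0.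
Qed.

Variables (X : nat -> Omega -> T1) (Y : nat -> Omega -> T2) (n : nat).
Hypotheses (mX : forall i, measurable_fun setT (X i))
  (mY : forall i, measurable_fun setT (Y i)).
Hypothesis XYE : forall (A : nat -> set T1) (B : nat -> set T2),
  (forall i, measurable (A i)) -> (forall i, measurable (B i)) ->
  P (\bigcap_(i in [set j | (j < n)%N]) (X i @^-1` A i `&` Y i @^-1` B i)) =
  \prod_(i < n) (m1 (A i) * m2 (B i)).

(* Rectangles are replaced by functions one coordinate at a time: the first
   [j] factors are arbitrary, the others are indicators of rectangles. *)
Let integral_prod_upto (j : nat) (f : nat -> T1 * T2 -> R) (I : nat -> R) :
  (j <= n)%N ->
  (forall i, measurable_fun setT (f i)) -> (forall i y, (0 <= f i y)%R) ->
  (forall i, \int[m1 \x m2]_y (f i y)%:E = (I i)%:E) ->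
  (forall i, (j <= i)%N -> exists A B,
     [/\ measurable A, measurable B & f i = \1_(A `*` B)]) ->
  \int[P]_w (\prod_(i < n) f i (X i w, Y i w))%:E = (\prod_(i < n) I i)%:E.
Proof.
have mXY i : measurable_fun setT (fun w => (X i w, Y i w)).
  exact: measurable_fun_pair.
elim: j f I => [|j IH] f I jn mf f0 fI fAB.
  have /choice[A /choice[B AB]] : forall i, exists A, exists B,
      [/\ measurable A, measurable B & f i = \1_(A `*` B)].
    by move=> i; exact: fAB.
  have mA i : measurable (A i) by have [] := AB i.
  have mB i : measurable (B i) by have [] := AB i.
  have IE i : m1 (A i) * m2 (B i) = (I i)%:E.
    rewrite -product_measure1E// -fI; have [_ _ ->] := AB i.
    by rewrite integral_indic ?setIT//; exact: measurableX.
  rewrite -prodEFin; under [RHS]eq_bigr do rewrite -IE.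
  rewrite -XYE// -[X in P X]setIT -integral_indic//; last first.
    apply: bigcap_measurableType => k _; apply: measurableI.
      by rewrite -[X in measurable X]setTI; exact: mX.
    by rewrite -[X in measurable X]setTI; exact: mY.
  apply: eq_integral => w _; congr (_%:E).
  have -> : (\prod_(i < n) f i (X i w, Y i w) =
             \prod_(i < n) \1_(X i @^-1` A i `&` Y i @^-1` B i) w)%R.
    apply: eq_bigr => i _; have [_ _ ->] := AB i.
    by rewrite !indicE; congr (_%:R)%R; apply/idP/idP; rewrite !inE.
  have [H|H] := pselect (forall i : 'I_n, (X i @^-1` A i `&` Y i @^-1` B i) w).
    rewrite big1; last by move=> i _; rewrite indicE mem_set.
    by rewrite indicE mem_set// => i /= ni; exact: (H (Ordinal ni)).
  have /existsNP[i Hi] := H.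
  rewrite (bigD1 i)//= indicE memNset// mul0r indicE memNset//.
  by move=> /(_ i (ltn_ord i)).
(* The factors other than the [j]-th form a nonnegative weight [W]. Then only rectangles have to be
   checked for the [j]-th factor, and replacing it by a rectangle indicator ([f'], [I']) leads back
   to the induction hypothesis. *)
pose o := Ordinal jn.
pose W w := (\prod_(i < n | i != o) f i (X i w, Y i w))%R.
have W0 w : (0 <= W w)%R by apply: prodr_ge0 => i _; exact: f0.
have mW : measurable_fun setT W.
  rewrite /W; under eq_fun do rewrite big_mkcond/=.
  apply: measurable_prod => i _; case: (i != o) => //.
  exact: (measurableT_comp (mf i) (mXY i)).
have I0 i : (0 <= I i)%R.
  by rewrite -lee_fin -fI; apply: integral_ge0 => y _; rewrite lee_fin.
transitivity (\int[P]_w ((f j (X j w, Y j w))%:E * (W w)%:E)).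
  by apply: eq_integral => w _; rewrite (bigD1 o)//= EFinM.
rewrite (@integral_weighted_product (fun w => (X j w, Y j w)) W
  (\prod_(i < n | i != o) I i) (fun y => (f j y)%:E))//.
- by rewrite fI -EFinM mulrC [in RHS](bigD1 o).
- by apply: prodr_ge0 => i _.
- move=> A B mA mB.
  have mAB : measurable (A `*` B) by exact: measurableX.
  pose f' i := if i == j then \1_(A `*` B) else f i.
  pose I' i := if i == j then fine (m1 A * m2 B) else I i.
  have fin : m1 A * m2 B \is a fin_num by rewrite fin_numM// fin_num_measure.
  have I'E : (\prod_(i < n) I' i = (\prod_(i < n | i != o) I i) *
      fine (m1 A * m2 B))%R.
    rewrite (bigD1 o)//= {1}/I' eqxx mulrC; congr (_ * _)%R.
    by apply: eq_bigr => i; rewrite -val_eqE/= /I' => /negbTE ->.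
  rewrite -[m1 A * m2 B]fineK// -EFinM -I'E -(IH f' I' (ltnW jn)).
  + rewrite integral_mkcond; apply: eq_integral => w _.
    rewrite epatch_indic /= (bigD1 o)//= /f' eqxx.
    rewrite (eq_bigr (fun i : 'I_n => f i (X i w, Y i w))); last first.
      by move=> i; rewrite -val_eqE/= => /negbTE ->.
    by rewrite EFinM muleC; congr (_ * _).
  + by move=> i; rewrite /f'; case: ifP => // _; exact: measurable_indic.
  + by move=> i y; rewrite /f'; case: ifP.
  + move=> i; rewrite /f' /I'; case: ifP => // _.
    by rewrite fineK// integral_indic// setIT; exact: product_measure1E.
  + move=> i; rewrite leq_eqVlt => /predU1P[<-|ji].
      by exists A, B; rewrite /f' eqxx.
    by rewrite /f' gtn_eqF//; exact: fAB.
- exact/measurable_EFinP.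
- by move=> y; rewrite lee_fin.
Qed.

Lemma integral_prod_independent (f : nat -> T1 * T2 -> R) (I : nat -> R) :
  (forall i, measurable_fun setT (f i)) -> (forall i y, (0 <= f i y)%R) ->
  (forall i, \int[m1 \x m2]_y (f i y)%:E = (I i)%:E) ->
  \int[P]_w (\prod_(i < n) f i (X i w, Y i w))%:E = (\prod_(i < n) I i)%:E.
Proof.
move=> mf f0 fI.
(* Factors of index at least [n] do not enter the product; the indicator of the whole space makes
   them meet the rectangle condition at [j = n]. *)
pose f' i := if (i < n)%N then f i else \1_(setT `*` setT).
pose I' i := if (i < n)%N then I i else 1%R.
rewrite (eq_bigr (fun i : 'I_n => I' i)); last first.
  by move=> i _; rewrite /I' ltn_ord.
rewrite -(@integral_prod_upto n f' I')//.
- apply: eq_integral => w _; congr (_%:E); apply: eq_bigr => i _.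
  by rewrite /f' ltn_ord.
- move=> i; rewrite /f'; case: ifP => // _; apply: measurable_indic.
  exact: measurableX.
- by move=> i y; rewrite /f'; case: ifP.
- move=> i; rewrite /f' /I'; case: ifP => // _.
  rewrite integral_indic ?setIT//; last exact: measurableX.
  rewrite [LHS]product_measure1E//.
  by rewrite -[RHS]mule1; congr (_ * _); exact: probability_setT.
- by move=> i ni; exists setT, setT; rewrite /f' ltnNge ni.
Qed.

End independent_pairs.

(** * Exponential moment of a single observation *)

Section gaussian_chernoff.
Context {R : realType}.
Local Open Scope ereal_scope.

(* [normal_prob] lives on [measurableTypeR R]; [noise_prob] is the same set
   function on [R] with its default measurable structure. *)
Definition noise_prob (nu : R) : set R -> \bar R := normal_prob 0 (Num.sqrt nu).

HB.instance Definition _ (nu : R) := isMeasure.Build _ _ _ (noise_prob nu)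
  (@measure0 _ _ _ (normal_prob 0 (Num.sqrt nu)))
  (@measure_ge0 _ _ _ (normal_prob 0 (Num.sqrt nu)))
  (@measure_semi_sigma_additive _ _ _ (normal_prob 0 (Num.sqrt nu))).

HB.instance Definition _ (nu : R) := Measure_isProbability.Build _ _ _
  (noise_prob nu) (@probability_setT _ _ _ (normal_prob 0 (Num.sqrt nu))).

(** Exponential tilting: completing the square turns [expR (t * x)] times the centred density into a
    constant times the density with mean [t * nu]. *)
Lemma noise_mgf (nu t : R) : (0 < nu)%R ->
  \int[noise_prob nu]_x (expR (t * x))%:E = (expR (t ^+ 2 * nu / 2))%:E.
Proof.
move=> nu0; set s := Num.sqrt nu.
have s0 : s != 0%R by rewrite sqrtr_eq0 -ltNge.
have s2 : (s ^+ 2 = nu)%R by rewrite sqr_sqrtr// ltW.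
have mpdf m : measurable_fun setT (normal_pdf m s : measurableTypeR R -> R).
  exact: (measurable_normal_pdf m s).
have mid : measurable_fun setT (idfun : measurableTypeR R -> R).
  exact: (@measurable_id _ R setT).
have mexp : measurable_fun setT (fun x : R => (expR (t * x))%:E).
  by apply/measurable_EFinP; apply: measurableT_comp => //; exact: measurable_funM.
rewrite (ge0_integral_transport (mu := lebesgue_measure) mid (mpdf 0%R)
  (normal_pdf_ge0 0 s))//.
transitivity (\int[lebesgue_measure]_x
    ((expR (t ^+ 2 * nu / 2))%:E * (normal_pdf (t * nu) s x)%:E)).
  apply: eq_integral => x _; rewrite -!EFinM !normal_pdfE//=; congr (_%:E).
  rewrite /normal_fun s2 mulrCA [RHS]mulrCA -!expRD; congr (_ * expR _)%R.
  by field; rewrite gt_eqF.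
rewrite ge0_integralZl//.
- by rewrite integral_normal_pdf mule1.
- exact/measurable_EFinP.
- by move=> x _; rewrite lee_fin normal_pdf_ge0.
Qed.

(** Since [expR t >= 1 + t], the left side is at most [1 - t / (1 + t)], and [t <= T] enlarges the
    denominator. A bound linear in [t] can be integrated, which brings in the second moment of
    [g]. *)
Lemma expRN_le_linear (t T : R) : (0 <= t)%R -> (t <= T)%R ->
  (expR (- t) <= 1 - t / (1 + T))%R.
Proof.
move=> t0 tT.
have t1 : (0 < 1 + t)%R by rewrite ltr_pwDl.
have T1 : (0 < 1 + T)%R by rewrite (lt_le_trans t1)// lerD2l.
rewrite expRN (@le_trans _ _ (1 + t)^-1)%R//.
  by rewrite lef_pV2 ?posrE ?expR_gt0// expR_ge1Dx.
have -> : ((1 + t)^-1 = 1 - t / (1 + t))%R by field; rewrite gt_eqF.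
by rewrite lerD2l lerN2 ler_wpM2l// lef_pV2 ?posrE// lerD2l.
Qed.

Context d (T : measurableType d).
Variables (m : probability T R) (g : T -> R) (K nu : R).
Hypotheses (mg : measurable_fun setT g) (gK : forall x, (`|g x| <= K)%R)
  (nu0 : (0 < nu)%R).

(* Among the weights [exp (- l (g^2 - 2 e g))], whose Gaussian integral is
   [exp (- (l - 2 l^2 nu) g^2)], the choice [l = 1 / (4 nu)] decays fastest. *)
Definition excess_weight (y : T * R) : R :=
  expR (- (g y.1 ^+ 2 - 2 * y.2 * g y.1) / (4 * nu)).

Lemma measurable_excess_weight : measurable_fun setT excess_weight.
Proof.
apply: measurableT_comp => //; apply: measurable_funM => //.
have mg1 : measurable_fun setT (fun y : T * R => g y.1).
  exact: measurableT_comp.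
apply: measurableT_comp => //; apply: measurable_funB.
  exact: measurable_funX.
by apply: measurable_funM => //; exact: measurable_funM.
Qed.

Let mg2 : measurable_fun setT (fun x => (g x ^+ 2)%:E : \bar R).
Proof. by apply/measurable_EFinP; exact: measurable_funX. Qed.

Let g2K x : (g x ^+ 2 <= K ^+ 2)%R.
Proof.
rewrite -real_normK ?num_real// ler_pXn2r ?nnegrE//.
exact: le_trans (normr_ge0 _) (gK x).
Qed.

Lemma integral_sqr_fin_num : \int[m]_x (g x ^+ 2)%:E \is a fin_num.
Proof.
rewrite ge0_fin_numE; last by apply: integral_ge0 => x _; rewrite lee_fin sqr_ge0.
apply: (@le_lt_trans _ _ (\int[m]_x (K ^+ 2)%:E)).
  by apply: ge0_le_integral => // x _; rewrite lee_fin ?sqr_ge0.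
by rewrite integral_cst//= [m setT]probability_setT mule1 ltry.
Qed.

(** The Gaussian integral in the noise leaves [expR (- (g x ^+ 2 / (8 * nu)))]. The linear bound
    with [T = K ^+ 2 / (8 * nu)] then gives at most [1 - v / c], where [v] is the second moment of
    [g], and [1 - u <= expR (- u)] concludes. *)
Lemma integral_excess_weight :
  exists2 I : R, \int[m \x noise_prob nu]_y (excess_weight y)%:E = I%:E
    & (0 <= I <= expR (- fine (\int[m]_x (g x ^+ 2)%:E) / (8 * nu + K ^+ 2)))%R.
Proof.
set c := (8 * nu + K ^+ 2)%R.
have c0 : (0 < c)%R by rewrite ltr_wpDr ?sqr_ge0// mulr_gt0.
have E : \int[m \x noise_prob nu]_y (excess_weight y)%:E =
    \int[m]_x (expR (- (g x ^+ 2 / (8 * nu))))%:E.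
  rewrite fubini_tonelli1//; last 2 first.
  - by apply/measurable_EFinP; exact: measurable_excess_weight.
  - by move=> y; rewrite lee_fin expR_ge0.
  apply: eq_integral => x _; rewrite /fubini_F.
  transitivity (\int[noise_prob nu]_y
     ((expR (- g x ^+ 2 / (4 * nu)))%:E * (expR (g x / (2 * nu) * y))%:E)).
    apply: eq_integral => y _; rewrite -EFinM -expRD; congr (expR _)%:E => /=.
    by field; rewrite gt_eqF.
  rewrite ge0_integralZl//; last first.
    by apply/measurable_EFinP/measurableT_comp => //; exact: measurable_funM.
  rewrite noise_mgf// -EFinM -expRD; congr (expR _)%:E.
  by field; rewrite gt_eqF.
set v := fine _.
have vE : \int[m]_x (g x ^+ 2)%:E = v%:E by rewrite fineK// integral_sqr_fin_num.
have le : \int[m]_x (expR (- (g x ^+ 2 / (8 * nu))))%:E <= (1 - v / c)%:E.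
  have -> : (1 - v / c)%:E = \int[m]_x (1 - (g x ^+ 2) / c)%:E.
    under eq_integral do rewrite EFinB EFinM muleC.
    rewrite integralB//=.
    - have -> : \int[m]_x (1 : \bar R) = 1.
        by rewrite integral_cst// mul1e; exact: probability_setT.
      rewrite ge0_integralZl ?lee_fin ?invr_ge0 ?ltW//.
        by rewrite vE -EFinM mulrC.
      by move=> x _; rewrite lee_fin sqr_ge0.
    - exact: finite_measure_integrable_cst.
    - apply: integrableZl => //; apply/integrableP; split => //.
      under eq_integral do rewrite /= ger0_norm ?sqr_ge0//.
      by rewrite vE ltry.
  apply: ge0_le_integral => //.
  - apply/measurable_EFinP/measurableT_comp => //.
    by apply: measurableT_comp => //; apply: measurable_funM => //; exact: measurable_funX.
  - apply/measurable_EFinP; apply: measurable_funB => //.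
    by apply: measurable_funM => //; exact: measurable_funX.
  - move=> x _; rewrite lee_fin.
    have := @expRN_le_linear (g x ^+ 2 / (8 * nu)) (K ^+ 2 / (8 * nu)).
    have -> : (g x ^+ 2 / (8 * nu) / (1 + K ^+ 2 / (8 * nu)) = g x ^+ 2 / c)%R.
      by rewrite /c; field; rewrite !gt_eqF//.
    apply; first by rewrite divr_ge0 ?sqr_ge0// mulr_ge0// ltW.
    by rewrite ler_wpM2r ?g2K// invr_ge0 mulr_ge0// ltW.
have I0 : 0 <= \int[m]_x (expR (- (g x ^+ 2 / (8 * nu))))%:E.
  by apply: integral_ge0 => x _; rewrite lee_fin expR_ge0.
exists (fine (\int[m]_x (expR (- (g x ^+ 2 / (8 * nu))))%:E)).
  by rewrite E fineK// ge0_fin_numE// (le_lt_trans le)// ltry.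
rewrite fine_ge0//=; apply: (@le_trans _ _ (1 - v / c)%R).
  by rewrite -lee_fin fineK// ge0_fin_numE// (le_lt_trans le)// ltry.
by rewrite mulNr expR_ge1Dx.
Qed.

End gaussian_chernoff.

(** * Deviation bounds for the sample sums *)

Section regression_deviations.
Context d0 d (Omega : measurableType d0) (T : measurableType d) (R : realType).
Local Open Scope ereal_scope.
Variables (P : probability Omega R) (m : probability T R) (nu : R)
  (X : nat -> Omega -> T) (eps : nat -> Omega -> R).
Hypotheses (nu0 : (0 < nu)%R) (mX : forall i, measurable_fun setT (X i))
  (meps : forall i, measurable_fun setT (eps i)).

(** The product of the weights is [expR (- S w / (4 * nu))], which is at least
    [expR (- t / (4 * nu))] on the event. Markov's inequality and independence reduce the bound to
    the [n]-th power of the single integral. *)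
Lemma chernoff_excess (n : nat) (g : T -> R) (K t : R) :
  (forall (A : nat -> set T) (B : nat -> set R),
    (forall i, measurable (A i)) -> (forall i, measurable (B i)) ->
    P (\bigcap_(i in [set j | (j < n)%N]) (X i @^-1` A i `&` eps i @^-1` B i)) =
    \prod_(i < n) (m (A i) * noise_prob nu (B i))) ->
  measurable_fun setT g -> (forall x, (`|g x| <= K)%R) ->
  P [set w | (\sum_(i < n) (g (X i w) ^+ 2 - 2 * eps i w * g (X i w)) <= t)%R] <=
  (expR (t / (4 * nu)) *
   expR (- (n%:R * fine (\int[m]_x (g x ^+ 2)%:E)) / (8 * nu + K ^+ 2)))%:E.
Proof.
move=> XeE mg gK.
set S := fun w => (\sum_(i < n) (g (X i w) ^+ 2 - 2 * eps i w * g (X i w)))%R.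
have mgX i : measurable_fun setT (fun w => g (X i w)) by exact: measurableT_comp.
have mS : measurable_fun setT S.
  apply: measurable_sum => i; apply: measurable_funB; first exact: measurable_funX.
  by apply: measurable_funM => //; exact: measurable_funM.
have mE : measurable [set w | (S w <= t)%R].
  rewrite -[X in measurable X]setTI; exact: measurable_fun_le.
have [I IE /andP[I0 Ile]] := integral_excess_weight m mg gK nu0.
have mw := measurable_excess_weight nu mg.
have := @integral_prod_independent _ _ _ _ _ _ _ P m (noise_prob nu) X eps n mX
  meps XeE (fun _ => excess_weight g nu) (fun _ => I) (fun _ => mw)
  (fun _ _ => expR_ge0 _) (fun _ => IE).
rewrite prodr_const card_ord => prodE.
have prodS w : (\prod_(i < n) excess_weight g nu (X i w, eps i w) =
    expR (- S w / (4 * nu)))%R.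
  rewrite /excess_weight -expR_sum; congr expR.
  by rewrite /S -sumrN mulr_suml; apply: eq_bigr.
apply: (@le_trans _ _ (\int[P]_w (expR (t / (4 * nu)) *
    \prod_(i < n) excess_weight g nu (X i w, eps i w))%:E)).
  rewrite -[X in P X]setIT -integral_indic//; apply: ge0_le_integral => //.
  - by apply/measurable_EFinP; exact: measurable_indic.
  - apply/measurable_EFinP; apply: measurable_funM => //.
    under eq_fun do rewrite prodS.
    apply: measurableT_comp => //; apply: measurable_funM => //.
    exact: measurableT_comp.
  - move=> w _; rewrite lee_fin indicE.
    have [|_] := boolP (w \in _); last first.
      by rewrite mulr_ge0 ?expR_ge0// prodS expR_ge0.
    rewrite inE/= => Sw; rewrite prodS -expRD -expR0 ler_expR.
    by rewrite -mulrDl mulr_ge0 ?subr_ge0// invr_ge0 mulr_ge0 ?ltW.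
under eq_integral do rewrite EFinM.
rewrite ge0_integralZl//.
- rewrite prodE -EFinM lee_fin ler_wpM2l ?expR_ge0//.
  rewrite (_ : - _ / _ = n%:R * (- fine (\int[m]_x (g x ^+ 2)%:E) / (8 * nu + K ^+ 2)))%R.
    by rewrite expRM_natl lerXn2r ?nnegrE ?expR_ge0.
  by rewrite -mulrN mulrA.
- apply/measurable_EFinP; under eq_fun do rewrite prodS.
  apply: measurableT_comp => //; apply: measurable_funM => //.
  exact: measurableT_comp.
- by move=> w _; rewrite lee_fin prodS expR_ge0.
Qed.

Hypothesis epsE : forall i B, measurable B -> P (eps i @^-1` B) = noise_prob nu B.

(** Follows from [|x| <= expR x + expR (- x)] and the exponential moments at [1] and [-1]. *)
Lemma integral_abs_noise i : \int[P]_w (`|eps i w|)%:E <= (2 * expR (nu / 2))%:E.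
Proof.
have epsE1 B : measurable B -> noise_prob nu B =
    \int[P]_(w in eps i @^-1` B) (cst 1%R w)%:E.
  move=> mB; rewrite -[RHS]/(\int[P]_(w in eps i @^-1` B) (cst 1 w)).
  have mV : measurable (eps i @^-1` B).
    by rewrite -[X in measurable X]setTI; exact: meps.
  by rewrite integral_cst// mul1e; exact/esym/epsE.
have mexp (s : R) : measurable_fun setT (fun x : R => (expR (s * x))%:E).
  by apply/measurable_EFinP; apply: measurableT_comp => //; exact: measurable_funM.
have mc : measurable_fun setT (cst 1%R : Omega -> R) by exact: measurable_cst.
have <- : \int[noise_prob nu]_x (`|x|)%:E = \int[P]_w (`|eps i w|)%:E.
  rewrite (ge0_integral_transport (meps i) mc
    (fun _ => ler01) epsE1 (f := fun x : R => (`|x|)%:E)).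
  - by apply: eq_integral => w _; rewrite mule1.
  - by apply/measurable_EFinP.
  - by move=> x; rewrite lee_fin.
apply: (@le_trans _ _ (\int[noise_prob nu]_x
    ((expR (1 * x))%:E + (expR (-1 * x))%:E))).
  apply: ge0_le_integral => //.
  - by apply/measurable_EFinP.
  - exact: emeasurable_funD.
  - move=> x _; rewrite -EFinD lee_fin mul1r mulN1r.
    have [x0|x0] := leP 0%R x.
      rewrite ger0_norm//; apply: ler_wpDr; first exact: expR_ge0.
      by rewrite (le_trans _ (expR_ge1Dx _))// lerDr.
    rewrite ltr0_norm//; apply: ler_wpDl; first exact: expR_ge0.
    by rewrite (le_trans _ (expR_ge1Dx _))// lerDr.
rewrite ge0_integralD//.
by rewrite !noise_mgf// -EFinD expr1n sqrrN expr1n mul1r -mulr2n mulr_natl.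
Qed.

(** A first moment bound of order [n] suffices: moving to a net of mesh [1/n] multiplies the sum of
    the [|eps i w|] by [1/n]. *)
Lemma markov_abs_noise (n : nat) (C : R) : (0 < n)%N -> (0 < C)%R ->
  P [set w | (n%:R * C <= \sum_(i < n) `|eps i w|)%R] <=
  (2 * expR (nu / 2) / C)%:E.
Proof.
move=> n0 C0.
have mS : measurable_fun setT (fun w => \sum_(i < n) `|eps i w|)%R.
  by apply: measurable_sum => i; exact: measurableT_comp.
have mE : measurable [set w | (n%:R * C <= \sum_(i < n) `|eps i w|)%R].
  rewrite -[X in measurable X]setTI; exact: measurable_fun_le.
have nC0 : (0 < n%:R * C)%R by rewrite mulr_gt0// ltr0n.
apply: (@le_trans _ _ (\int[P]_w
    ((n%:R * C)^-1%:E * (\sum_(i < n) `|eps i w|)%R%:E))).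
  rewrite -[X in P X]setIT -integral_indic//; apply: ge0_le_integral => //.
  - by apply/measurable_EFinP; exact: measurable_indic.
  - by apply: measurable_funeM; exact/measurable_EFinP.
  - move=> w _; rewrite -EFinM lee_fin indicE.
    have [|_] := boolP (w \in _); last first.
      by rewrite mulr_ge0 ?invr_ge0 ?(ltW nC0)// sumr_ge0.
    by rewrite inE/= => H; rewrite mulrC ler_pdivlMr// mul1r.
rewrite ge0_integralZl//; last 3 first.
- exact/measurable_EFinP.
- by move=> w _; rewrite lee_fin sumr_ge0.
- by rewrite lee_fin invr_ge0 ltW.
under eq_integral do rewrite -sumEFin.
rewrite ge0_integral_sum//; last first.
  by move=> i; apply/measurable_EFinP; exact: measurableT_comp.
apply: (@le_trans _ _ ((n%:R * C)^-1%:E * \sum_(i < n) (2 * expR (nu / 2))%:E)).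
  rewrite lee_wpmul2l ?lee_fin ?invr_ge0 ?(ltW nC0)//.
  by apply: lee_sum => i _; exact: integral_abs_noise.
rewrite sumEFin -EFinM lee_fin sumr_const card_ord -mulr_natl.
rewrite le_eqVlt; apply/orP; left; apply/eqP; field.
by rewrite gt_eqF// pnatr_eq0 -lt0n.
Qed.

End regression_deviations.

(** * Regularity of the regression functions in the input and in the parameters *)

Section gated_regression_functions.
Context {R : realType} {d q : nat}.
Implicit Types (h : 'rV[R]_d -> 'rV[R]_q -> R) (a : atom R d q)
  (G : seq (atom R d q)).

Lemma continuous_measurable_Rd (f : 'rV[R]_d -> R) :
  continuous f -> measurable_fun [set: Rd R d] (f : Rd R d -> R).
Proof.
move=> /continuousP cf; apply: (measurability _ (RGenOpens.measurableE R)).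
move=> _ [_ [a [b ->] <-]]; rewrite setTI; apply: sub_sigma_algebra.
exact/cf/interval_open.
Qed.

(** Decreasing in [t]: the sign of the exponent is that of [sigmoid], not of the usual logistic
    function. *)
Definition logistic (t : R) : R := 1 / (1 + expR t).

Lemma logistic_itv t : 0 <= logistic t <= 1.
Proof.
have e0 : 0 < 1 + expR t by rewrite ltr_wpDr ?expR_ge0.
rewrite /logistic; apply/andP; split; first by rewrite divr_ge0 ?(ltW e0).
by rewrite ler_pdivrMr// mul1r lerDl expR_ge0.
Qed.

(** For [s <= t] the difference is [expR t - expR s] over a denominator at least [expR t], hence at
    most [1 - expR (s - t) <= t - s]. *)
Lemma logistic_lipschitz s t : `|logistic s - logistic t| <= `|s - t|.
Proof.
wlog st : s t / s <= t.
  move=> H; have [/H//|/ltW/H] := leP s t.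
  by rewrite distrC [X in _ <= X]distrC.
have es : 0 < 1 + expR s by rewrite ltr_wpDr ?expR_ge0.
have et : 0 < 1 + expR t by rewrite ltr_wpDr ?expR_ge0.
have et0 := expR_gt0 t.
have -> : logistic s - logistic t = (expR t - expR s) / ((1 + expR s) * (1 + expR t)).
  by rewrite /logistic; field; rewrite !gt_eqF.
have ets : 0 <= expR t - expR s by rewrite subr_ge0 ler_expR.
rewrite ger0_norm; last by rewrite divr_ge0// mulr_ge0// ltW.
rewrite distrC ger0_norm ?subr_ge0//.
apply: (@le_trans _ _ ((expR t - expR s) / expR t)).
  rewrite ler_wpM2l// lef_pV2 ?posrE ?mulr_gt0//.
  by have es0 := expR_gt0 s; nra.
rewrite mulrBl divff ?gt_eqF// -expRB lerBlDr.
by have := expR_ge1Dx (s - t); lra.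
Qed.

Lemma continuous_logistic : continuous logistic.
Proof.
move=> t; rewrite /logistic; apply: cvgM; first exact: cvg_cst.
apply: cvgV; first by rewrite gt_eqF// ltr_wpDr ?expR_ge0.
by apply: cvgD; [exact: cvg_cst|exact: continuous_expR].
Qed.

Lemma sigmoidE (x b1 : 'rV[R]_d) (b0 : R) :
  sigmoid x b1 b0 = logistic (- (\sum_(i < d) b1 0 i * x 0 i) - b0).
Proof. by []. Qed.

Lemma le_coord_norm n (x : 'rV[R]_n) i : `|x 0 i| <= `|x|.
Proof.
rewrite [leRHS]/Num.norm /= mx_normrE; apply/bigmax_geP; right => /=.
by exists (0, i).
Qed.

Lemma norm_le_coord n (x : 'rV[R]_n) (C : R) :
  0 <= C -> (forall i, `|x 0 i| <= C) -> `|x| <= C.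
Proof.
move=> C0 xC; rewrite [leLHS]/Num.norm /= mx_normrE; apply/bigmax_leP; split => //.
by case=> i j _ /=; rewrite ord1.
Qed.

Lemma sigmoid_lipschitz (x b b' : 'rV[R]_d) (b0 b0' C r : R) :
  `|x| <= C -> `|b - b'| <= r -> `|b0 - b0'| <= r ->
  `|sigmoid x b b0 - sigmoid x b' b0'| <= (d%:R * C + 1) * r.
Proof.
move=> xC br b0r; rewrite !sigmoidE; apply: le_trans (logistic_lipschitz _ _) _.
have -> : - (\sum_(i < d) b 0 i * x 0 i) - b0 - (- (\sum_(i < d) b' 0 i * x 0 i) - b0')
    = - (\sum_(i < d) (b - b') 0 i * x 0 i) - (b0 - b0').
  have -> : \sum_(i < d) (b - b') 0 i * x 0 i =
      \sum_(i < d) b 0 i * x 0 i - \sum_(i < d) b' 0 i * x 0 i.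
    by rewrite -sumrB; apply: eq_bigr => i _; rewrite !mxE mulrBl.
  by ring.
rewrite mulrDl mul1r (le_trans (ler_normB _ _))// lerD// normrN.
rewrite (le_trans (ler_norm_sum _ _ _))//.
apply: (@le_trans _ _ (\sum_(i < d) r * C)).
  apply: ler_sum => i _; rewrite normrM ler_pM//.
    exact: le_trans (le_coord_norm _ _) br.
  exact: le_trans (le_coord_norm _ _) xC.
by rewrite sumr_const card_ord -[leLHS]mulr_natl mulrA mulrAC.
Qed.

Lemma measurable_regfun h G :
  (forall e, measurable_fun [set: Rd R d] (fun x : Rd R d => h x e)) ->
  measurable_fun [set: Rd R d] (fun x : Rd R d => regfun h G x).
Proof.
move=> mh; apply: measurable_sum => a; apply: measurable_funM; last exact: mh.
under eq_fun do rewrite sigmoidE.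
apply: (measurableT_comp (continuous_measurable_fun continuous_logistic)).
apply: measurable_funB => //; apply: measurableT_comp => //.
apply: measurable_sum => i; apply: measurable_funM => //.
apply: (@continuous_measurable_Rd (fun x => x 0 i)).
exact: coord_continuous.
Qed.

Lemma regfun_bounded h G (x : 'rV[R]_d) (B : R) :
  (forall e, `|h x e| <= B) -> `|regfun h G x| <= (size G)%:R * B.
Proof.
move=> hB; rewrite (le_trans (ler_norm_sum _ _ _))//.
apply: (@le_trans _ _ (\sum_(a <- G) B)); last first.
  by rewrite big_const_seq count_predT iter_addr_0 mulr_natl.
apply: ler_sum => a _; rewrite normrM -[leRHS]mul1r ler_pM//.
have /andP[s0 s1] := logistic_itv (- (\sum_(i < d) a.2.1 0 i * x 0 i) - a.1).
by rewrite sigmoidE ger0_norm.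
Qed.

Definition atom_close (r : R) a a' :=
  [/\ `|a.1 - a'.1| <= r, `|a.2.1 - a'.2.1| <= r & `|a.2.2 - a'.2.2| <= r].

(** Each atom contributes [(s - s') * h + s' * (h - h')]: the gate is Lipschitz and [h] bounded in
    the first term, the gate is at most 1 and [h] Lipschitz in the second. Writing the second list
    as a [map] pairs the atoms. *)
Lemma regfun_close h G (f : atom R d q -> atom R d q) (x : 'rV[R]_d)
    (B C L r : R) :
  `|x| <= C -> (forall e, `|h x e| <= B) ->
  (forall e e', `|h x e - h x e'| <= L * `|e - e'|) -> 0 <= L ->
  (forall a, a \in G -> atom_close r a (f a)) ->
  `|regfun h G x - regfun h (map f G) x| <=
    (size G)%:R * (((d%:R * C + 1) * B + L) * r).
Proof.
move=> xC hB hL L0; elim: G => [|a G IH] Gf.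
  by rewrite /regfun /= !big_nil subrr normr0 mul0r.
rewrite /regfun /= !big_cons opprD addrACA -/(regfun h G x) -/(regfun h _ x).
rewrite -natr1 mulrDl mul1r addrC; apply: le_trans (ler_normD _ _) _.
apply: lerD; first by apply: IH => b bG; apply: Gf; rewrite in_cons bG orbT.
have [r1 r2 r3] : atom_close r a (f a) by apply: Gf; rewrite mem_head.
set s := sigmoid _ _ _; set s' := sigmoid _ _ _.
have ss' : `|s - s'| <= (d%:R * C + 1) * r by exact: sigmoid_lipschitz.
have /andP[s0 s1] : 0 <= s' <= 1 by rewrite /s' sigmoidE logistic_itv.
have -> : s * h x a.2.2 - s' * h x (f a).2.2 =
    (s - s') * h x a.2.2 + s' * (h x a.2.2 - h x (f a).2.2) by ring.
rewrite (le_trans (ler_normD _ _))// [leRHS]mulrDl lerD//.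
  by rewrite normrM mulrAC ler_pM.
rewrite normrM ger0_norm// -[leRHS]mul1r ler_pM//.
by rewrite (le_trans (hL _ _))// ler_wpM2l.
Qed.

End gated_regression_functions.

(** * Finite nets of parameters and of lists of atoms *)

Section nets.
Context {R : realType}.

Definition grid (T r : R) (s : nat) : 'I_s -> R := fun j => j%:R * r - T.

Lemma grid_close (T r x : R) (s : nat) : 0 < r -> `|x| <= T ->
  (Num.truncn (2 * T / r) < s)%N -> exists j : 'I_s, `|x - grid T r j| <= r.
Proof.
move=> r0; rewrite ler_norml => /andP[Tx xT] ts.
have y0 : 0 <= (x + T) / r by rewrite divr_ge0 ?(ltW r0)//; lra.
have /andP[jl ju] := truncn_itv y0.
have js : (Num.truncn ((x + T) / r) < s)%N.
  apply: leq_ltn_trans ts; apply: le_truncn; rewrite ler_wpM2r ?invr_ge0 ?(ltW r0)//; lra.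
exists (Ordinal js); rewrite /grid /=.
move: (Num.truncn _) jl ju {js} => j.
rewrite ler_pdivlMr// ltr_pdivrMr// -natr1 [(_ + 1) * r]mulrDl mul1r => jl ju.
by rewrite ler_norml; apply/andP; split; lra.
Qed.

Definition rV_net (T r : R) (s n : nat) : seq 'rV[R]_n :=
  [seq \row_i grid T r (f i) | f : {ffun 'I_n -> 'I_s}].

Lemma size_rV_net T r s n : size (rV_net T r s n) = (s ^ n)%N.
Proof. by rewrite size_map -cardE card_ffun !card_ord. Qed.

Lemma rV_net_close (T r : R) (s n : nat) (x : 'rV[R]_n) : 0 < r -> `|x| <= T ->
  (Num.truncn (2 * T / r) < s)%N ->
  exists2 y, y \in rV_net T r s n & `|x - y| <= r.
Proof.
move=> r0 xT ts.
have /choice[f fP] : forall i, exists j : 'I_s, `|x 0 i - grid T r j| <= r.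
  by move=> i; apply: grid_close => //; exact: le_trans (le_coord_norm _ _) xT.
exists (\row_i grid T r ([ffun i => f i] i)).
  by apply: (map_f (fun f : {ffun 'I_n -> 'I_s} => _)); rewrite mem_enum.
by apply: norm_le_coord => [|i]; [exact: ltW|rewrite !mxE ffunE].
Qed.

Context {d q : nat}.

Definition atom_net (T r : R) (s : nat) : seq (atom R d q) :=
  [seq (b, w) | b <- [seq grid T r j | j : 'I_s],
    w <- [seq (b1, e) | b1 <- rV_net T r s d, e <- rV_net T r s q]].

Lemma size_atom_net T r s : size (atom_net T r s) = (s ^ (1 + (d + q)))%N.
Proof.
by rewrite !size_allpairs !size_rV_net size_map -cardE card_ord !expnD expn1.
Qed.

Lemma atom_net_close (T r : R) (s : nat) (a : atom R d q) : 0 < r ->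
  `|a.1| <= T -> `|a.2.1| <= T -> `|a.2.2| <= T ->
  (Num.truncn (2 * T / r) < s)%N ->
  exists2 a', a' \in atom_net T r s & atom_close r a a'.
Proof.
move=> r0 T1 T2 T3 ts.
have [j jP] := grid_close r0 T1 ts.
have [b bN bP] := rV_net_close r0 T2 ts.
have [e eN eP] := rV_net_close r0 T3 ts.
exists (grid T r j, (b, e)) => //; apply: allpairs_f; last exact: allpairs_f.
by apply: map_f; rewrite mem_enum.
Qed.

(** All lengths up to [k] are included because the number of fitted atoms varies with the data. *)
Fixpoint lists_upto (T : eqType) (A : seq T) (k : nat) : seq (seq T) :=
  if k is k'.+1 then [::] :: [seq a :: l | a <- A, l <- lists_upto A k']
  else [:: [::]].

Lemma size_lists_upto (T : eqType) (A : seq T) k :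
  (size (lists_upto A k) <= (size A).+1 ^ k)%N.
Proof.
elim: k => // k IH; rewrite /= size_allpairs expnS mulSn -add1n.
by rewrite leq_add ?expn_gt0// leq_mul2l IH orbT.
Qed.

Lemma mem_lists_upto (T : eqType) (A : seq T) k (l : seq T) :
  (size l <= k)%N -> {subset l <= A} -> l \in lists_upto A k.
Proof.
elim: k l => [|k IH] [|a l]//= lk lA; rewrite in_cons /=.
apply: allpairs_f; first by apply: lA; rewrite mem_head.
by apply: IH => // b bl; apply: lA; rewrite in_cons bl orbT.
Qed.

Lemma lists_upto_size (T : eqType) (A : seq T) k (l : seq T) :
  l \in lists_upto A k -> (size l <= k)%N.
Proof.
elim: k l => [|k IH] l /=; first by rewrite mem_seq1 => /eqP ->.
rewrite in_cons => /predU1P[->//|/allpairsP[[a l'] [_ /IH ? ->]]] //.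
Qed.

End nets.

(** * Union bound over a finite net *)

Section net_argument.
Context d0 d (Omega : measurableType d0) (T : measurableType d) (R : realType).
Local Open Scope ereal_scope.
Variables (P : probability Omega R) (m : probability T R) (nu : R)
  (X : nat -> Omega -> T) (eps : nat -> Omega -> R) (n : nat).
Hypotheses (nu0 : (0 < nu)%R) (mX : forall i, measurable_fun setT (X i))
  (meps : forall i, measurable_fun setT (eps i)).
Hypothesis XeE : forall (A : nat -> set T) (B : nat -> set R),
  (forall i, measurable (A i)) -> (forall i, measurable (B i)) ->
  P (\bigcap_(i in [set j | (j < n)%N]) (X i @^-1` A i `&` eps i @^-1` B i)) =
  \prod_(i < n) (m (A i) * noise_prob nu (B i)).
Hypothesis epsE : forall i B, measurable B -> P (eps i @^-1` B) = noise_prob nu B.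

Lemma measure_bigsetU_le_const (I : eqType) (s : seq I) (E : I -> set Omega) (c : R) :
  (forall j, j \in s -> measurable (E j)) ->
  (forall j, j \in s -> P (E j) <= c%:E) ->
  P (\big[setU/set0]_(j <- s) E j) <= ((size s)%:R * c)%:E.
Proof.
elim: s => [|a s IH] mE PE; first by rewrite big_nil measure0 mul0r.
have mS : measurable (\big[setU/set0]_(j <- s) E j).
  rewrite big_seq; apply: bigsetU_measurable => j js.
  by apply: mE; rewrite in_cons js orbT.
rewrite big_cons /= -natr1 mulrDl mul1r addrC EFinD.
apply: (@le_trans _ _ (P (E a) + P (\big[setU/set0]_(j <- s) E j))).
  by apply: measureU2 => //; apply: mE; rewrite mem_head.
apply: leeD; first by apply: PE; rewrite mem_head.
by apply: IH => j js; [apply: mE|apply: PE]; rewrite in_cons js orbT.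
Qed.

(** The exceptional set is fixed before [f], so the bound applies to an [f] chosen from the data at
    [w]. It collects the outcomes with mean absolute noise at least [C], and those where some net
    element with [n] times its second moment at least [t] has a small excess sum. *)
Lemma net_excess_bound (I : eqType) (s : seq I) (g : I -> T -> R) (K C t : R) :
  (0 < n)%N -> (0 < C)%R ->
  (forall j, j \in s -> measurable_fun setT (g j)) ->
  (forall j x, j \in s -> (`|g j x| <= K)%R) ->
  exists A : set Omega, [/\ measurable A,
    P A <= (2 * expR (nu / 2) / C + (size s)%:R *
      (expR ((2 * K + 2 * C) / (4 * nu)) * expR (- t / (8 * nu + K ^+ 2))))%:E &
    forall w, ~ A w -> forall f : T -> R, measurable_fun setT f ->
      (forall x, (`|f x| <= K)%R) ->
      (exists2 j, j \in s & forall x, (`|f x - g j x| <= n%:R^-1)%R) ->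
      (\sum_(i < n) f (X i w) ^+ 2 <= 2 * \sum_(i < n) eps i w * f (X i w))%R ->
      (n%:R * fine (\int[m]_x (f x ^+ 2)%:E) <= 2 * t + 2 / n%:R)%R].
Proof.
move=> n0 C0 mg gK.
have nR0 : (0 < n%:R :> R)%R by rewrite ltr0n.
pose v j := fine (\int[m]_x (g j x ^+ 2)%:E).
pose S j w := (\sum_(i < n) (g j (X i w) ^+ 2 - 2 * eps i w * g j (X i w)))%R.
pose E j := if (t <= n%:R * v j)%R then [set w | (S j w <= 2 * K + 2 * C)%R] else set0.
have mE j : j \in s -> measurable (E j).
  move=> js; rewrite /E; case: ifP => // _.
  rewrite -[X in measurable X]setTI; apply: measurable_fun_le => //.
  apply: measurable_sum => i.
  have mgX : measurable_fun setT (fun w => g j (X i w)).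
    exact: (measurableT_comp (mg _ js) (mX i)).
  apply: measurable_funB; first exact: measurable_funX.
  by apply: measurable_funM => //; exact: measurable_funM.
set c := (expR ((2 * K + 2 * C) / (4 * nu)) * expR (- t / (8 * nu + K ^+ 2)))%R.
have c0 : (0 <= c)%R by rewrite mulr_ge0 ?expR_ge0.
have PE j : j \in s -> P (E j) <= c%:E.
  move=> js; rewrite /E; case: ifPn => [tv|_]; last by rewrite measure0 lee_fin.
  have := chernoff_excess nu0 mX meps (2 * K + 2 * C)%R XeE (mg _ js)
    (fun x => gK _ x js).
  move=> /le_trans; apply.
  rewrite lee_fin ler_wpM2l ?expR_ge0// ler_expR ler_wpM2r ?lerN2//.
  by rewrite invr_ge0 addr_ge0 ?sqr_ge0// mulr_ge0 ?(ltW nu0).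
pose Z := [set w | (n%:R * C <= \sum_(i < n) `|eps i w|)%R].
have mZ : measurable Z.
  rewrite -[X in measurable X]setTI; apply: measurable_fun_le => //.
  by apply: measurable_sum => i; exact: measurableT_comp.
have mU : measurable (\big[setU/set0]_(j <- s) E j).
  by rewrite big_seq; apply: bigsetU_measurable => j js; exact: mE.
exists (Z `|` \big[setU/set0]_(j <- s) E j); split.
- exact: measurableU.
- apply: (@le_trans _ _ (P Z + P (\big[setU/set0]_(j <- s) E j))).
    exact: measureU2.
  rewrite EFinD; apply: leeD.
    exact: markov_abs_noise.
  exact: measure_bigsetU_le_const.
move=> w /not_orP[nZ nU] f mf fK [j js fg] fS.
have noise : (\sum_(i < n) `|eps i w| < n%:R * C)%R by rewrite ltNge; exact/negP.
have nE : ~ E j w.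
  by move=> Ejw; apply: nU; rewrite (big_rem j)//=; left.
(* With [g = g j], the summands for [g] and [f] differ by [(g - f) * (g + f - 2 * e)], of size at
   most [(2 * K + 2 * |e|) / n]. Summed over the sample this costs [2 * K + 2 * C], while the sum
   for [f] is nonpositive. *)
have gsmall : (S j w <= 2 * K + 2 * C)%R.
  have : (S j w <= \sum_(i < n) (f (X i w) ^+ 2 - 2 * eps i w * f (X i w)) +
      \sum_(i < n) (n%:R^-1 * (2 * K) + n%:R^-1 * (2 * `|eps i w|)))%R.
    rewrite -big_split/=; apply: ler_sum => i _.
    set x := X i w; set e := eps i w.
    have : (`|(g j x - f x) * (g j x + f x - 2 * e)| <=
        n%:R^-1 * (2 * K + 2 * `|e|))%R.
      rewrite normrM ler_pM//; first by rewrite distrC.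
      apply: le_trans (ler_normB _ _) _; rewrite lerD//.
        by apply: le_trans (ler_normD _ _) _; rewrite mulr_natl mulr2n lerD// gK.
      by rewrite normrM ger0_norm.
    by move/ler_normlW; lra.
  rewrite sumrB big_split/= sumr_const card_ord -[(_ *+ n)%R]mulr_natl mulrA.
  rewrite divff ?gt_eqF// mul1r -mulr_sumr -mulr_sumr => H.
  have fS' : (\sum_(i < n) 2 * eps i w * f (X i w) =
      2 * \sum_(i < n) eps i w * f (X i w))%R.
    by rewrite mulr_sumr; apply: eq_bigr => i _; rewrite mulrA.
  have : (n%:R^-1 * (2 * \sum_(i < n) `|eps i w|) <= 2 * C)%R.
    by rewrite mulrC ler_pdivrMr//; lra.
  by lra.
have vt : (n%:R * v j < t)%R.
  by rewrite ltNge; apply/negP => tv; apply: nE; rewrite /E tv.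
have fin_g := integral_sqr_fin_num m (mg _ js) (fun x => gK _ x js).
have fin_f := integral_sqr_fin_num m mf fK.
have mg2 : measurable_fun setT (fun x => (g j x ^+ 2)%:E : \bar R).
  by apply/measurable_EFinP; apply: measurable_funX; exact: mg.
have mf2 : measurable_fun setT (fun x => (f x ^+ 2)%:E : \bar R).
  by apply/measurable_EFinP; exact: measurable_funX.
(* Integrates [f ^+ 2 <= 2 * g ^+ 2 + 2 * (f - g) ^+ 2], the gap being the square of [f - 2 * g]. *)
have fv : (fine (\int[m]_x (f x ^+ 2)%:E) <= 2 * v j + 2 * n%:R^-1 ^+ 2)%R.
  rewrite -lee_fin fineK// EFinD EFinM fineK//.
  have -> : 2%:E * \int[m]_x (g j x ^+ 2)%:E + (2 * n%:R^-1 ^+ 2)%:E =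
      \int[m]_x (2%:E * (g j x ^+ 2)%:E + (2 * n%:R^-1 ^+ 2)%:E).
    rewrite ge0_integralD//.
    - rewrite ge0_integralZl//; last by move=> x _; rewrite lee_fin sqr_ge0.
      rewrite integral_cst//; congr (_ + _).
      by rewrite -[LHS]mule1; congr (_ * _); apply/esym; exact: probability_setT.
    - by move=> x _; rewrite -EFinM lee_fin mulr_ge0// sqr_ge0.
    - exact: measurable_funeM.
  apply: ge0_le_integral => //.
  - by move=> x _; rewrite lee_fin sqr_ge0.
  - by apply: emeasurable_funD => //; exact: measurable_funeM.
  - move=> x _; rewrite -EFinM -EFinD lee_fin.
    have : (`|f x - g j x| ^+ 2 <= n%:R^-1 ^+ 2)%R.
      by rewrite ler_pXn2r ?nnegrE ?invr_ge0 ?(ltW nR0).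
    rewrite real_normK ?num_real// => H.
    by have := sqr_ge0 (f x - 2 * g j x)%R; nra.
have := fv; rewrite -(ler_pM2l nR0) => /le_trans; apply.
have -> : (n%:R * (2 * v j + 2 * n%:R^-1 ^+ 2) = 2 * (n%:R * v j) + 2 / n%:R)%R.
  by field; rewrite gt_eqF.
by rewrite lerD2r ler_wpM2l// ltW.
Qed.

End net_argument.

(** * The L2 norm and the cardinality of the net *)

Section final_estimates.
Context {R : realType}.

Lemma Lnorm2_le d (T : measurableType d) (mu : {measure set T -> \bar R})
    (f g : T -> R) (c : R) : 0 <= c ->
  measurable_fun setT f -> measurable_fun setT g -> {ae mu, forall x, g x = f x} ->
  (\int[mu]_x (f x ^+ 2)%:E <= (c ^+ 2)%:E)%E ->
  ('N[mu]_2%:E[EFin \o g] <= c%:E)%E.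
Proof.
move=> c0 mf mg gf fc.
have mf2 : measurable_fun setT (fun x => (f x ^+ 2)%:E : \bar R).
  by apply/measurable_EFinP; exact: measurable_funX.
have mg2 : measurable_fun setT (fun x => (g x ^+ 2)%:E : \bar R).
  by apply/measurable_EFinP; exact: measurable_funX.
have E : (\int[mu]_x (`|(EFin \o g) x| `^ 2) = \int[mu]_x (f x ^+ 2)%:E)%E.
  transitivity (\int[mu]_x (g x ^+ 2)%:E)%E.
    apply: eq_integral => x _.
    by rewrite [X in (X `^ _)%E]/= poweR_EFin powR_mulrn// real_normK// num_real.
  apply: ge0_ae_eq_integral => //.
  - by move=> x _; rewrite lee_fin sqr_ge0.
  - by move=> x _; rewrite lee_fin sqr_ge0.
  - by apply: filterS gf => x /= -> _.
have If0 : (0 <= \int[mu]_x (f x ^+ 2)%:E)%E.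
  by apply: integral_ge0 => x _; rewrite lee_fin sqr_ge0.
rewrite unlock E poweR12_sqrt//.
move: If0 fc; case: (\int[mu]_x _)%E => [I| |]//=; rewrite !lee_fin => I0 Ic.
by rewrite -(ger0_norm c0) -sqrtr_sqr ler_wsqrtr.
Qed.

(** The number of grid points per coordinate is at most [n ^ 2]; the extra successor is absorbed by
    one more factor [n >= 2]. *)
Lemma net_card_le (a : R) (n D k : nat) : 0 <= a -> a + 2 <= n%:R ->
  (((Num.truncn (a * n%:R)).+1 ^ D).+1 ^ k <= n ^ ((2 * D + 1) * k))%N.
Proof.
move=> a0 an; have n2 : (2 <= n)%N by rewrite -(ler_nat R); lra.
have exp_mono m1 m2 p : (m1 <= m2)%N -> (m1 ^ p <= m2 ^ p)%N.
  by case: p => // p; rewrite leq_exp2r.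
rewrite expnM; apply: (exp_mono _ _ _).
have sn : ((Num.truncn (a * n%:R)).+1 <= n ^ 2)%N.
  rewrite -(ler_nat R) -natr1 natrX.
  have : (Num.truncn (a * n%:R))%:R <= a * n%:R.
    by rewrite truncn_le mulr_ge0.
  have : 2 <= n%:R :> R by rewrite (ler_nat R 2).
  by nra.
apply: (@leq_trans (n ^ (2 * D)).+1).
  by rewrite ltnS expnM; apply: (exp_mono _ _ _).
rewrite expnD expn1 (@leq_trans (n ^ (2 * D) * 2))// ?leq_mul2l ?n2 ?orbT//.
by rewrite muln2 -addnn -addn1 leq_add2l expn_gt0 (leq_trans _ n2).
Qed.

End final_estimates.

(** * The rate of the least squares estimator: choice of constants and assembly *)

Theorem theorem1
  (R : realType) (d q : nat)
  (* probability space carrying the data *)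
  (dO : measure_display) (Omega : measurableType dO) (P : probability Omega R)
  (* input distribution, noise variance, covariates, noise *)
  (mu : probability (Rd R d) R) (nu : R)
  (X : nat -> Omega -> Rd R d) (eps : nat -> Omega -> R)
  (* expert function, parameter set, number of fitted experts, true mixing measure *)
  (h : 'rV[R]_d -> 'rV[R]_q -> R) (Theta : set (atom R d q)) (k : nat)
  (Gs : seq (atom R d q))
  (* the least squares estimator (one for each sample size n and outcome w) *)
  (Ghat : nat -> Omega -> seq (atom R d q)) :
  0 < nu ->
  regression_design P mu nu X eps ->
  (* G_* has k_* = size Gs atoms, lies in G_{k_*}(Theta), and k > k_* *)
  in_Gk Theta (size Gs) Gs ->
  (size Gs < k)%N ->
  (* (A.1) Theta compact, input space bounded *)
  compact Theta ->
  (exists C : R, mu [set x : Rd R d | `|x| <= C] = 1%E) ->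
  (* (A.2) h Lipschitz in eta and bounded, mu-a.s. (and measurable in x) *)
  (forall e, measurable_fun [set: Rd R d] (fun x : Rd R d => h x e)) ->
  (exists L B : R, {ae mu, forall x : Rd R d,
       (forall e e' : 'rV[R]_q, `|h x e - h x e'| <= L * `|e - e'|) /\
       (forall e : 'rV[R]_q, `|h x e| <= B)}) ->
  (* (A.3) eta*_1, ..., eta*_{k_*} pairwise distinct *)
  uniq [seq a.2.2 | a <- Gs] ->
  (* Ghat n w is a least squares estimator over G_k(Theta) based on (X_i, Y_i)_{i<n},
     with Y_i = f_{G_*}(X_i) + eps_i *)
  (forall n w, in_Gk Theta k (Ghat n w) /\
     forall G, in_Gk Theta k G ->
       \sum_(i < n) (regfun h Gs (X i w) + eps i w - regfun h (Ghat n w) (X i w)) ^+ 2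
       <= \sum_(i < n) (regfun h Gs (X i w) + eps i w - regfun h G (X i w)) ^+ 2) ->
  (* Regime 1: every over-specified true gating parameter beta*_{1j} equals 0_d *)
  (forall n w (j : 'I_(size Gs)),
     (2 <= voronoi_card Gs (Ghat n w) j)%N -> (nth (atom0 R d q) Gs j).2.1 = 0) ->
  (* conclusion: || f_{Ghat_n} - f_{G_*} ||_{L2(mu)} = O_P( (log n / n)^{1/2} ),
     with outer probability *)
  forall e : R, 0 < e ->
  exists M : R, 0 < M /\ exists N : nat, forall n : nat, (N <= n)%N ->
    exists A : set Omega, measurable A /\
      [set w | ((M * Num.sqrt (ln n%:R / n%:R))%:E
                < 'N[mu]_2%:E[EFin \o (fun x : Rd R d => (regfun h (Ghat n w) x - regfun h Gs x)%R)])%E]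
        `<=` A /\ (P A <= e%:E)%E.
Proof.
move=> nu0 [mX meps muX epsE XeE] [/andP[Gs0 _] GsT] Gsk cT [C0 muC] mh
  [L0 [B0 aeh]] _ LSE _ e e0.
have epsN i B : measurable B -> P (eps i @^-1` B) = noise_prob nu B.
  exact: epsE.
have XeN n (A : nat -> set (Rd R d)) (B : nat -> set R) :
    (forall i, measurable (A i)) -> (forall i, measurable (B i)) ->
    P (\bigcap_(i in [set j | (j < n)%N]) (X i @^-1` A i `&` eps i @^-1` B i)) =
    (\prod_(i < n) (mu (A i) * noise_prob nu (B i)))%E.
  by move=> mA mB; rewrite XeE//; apply: eq_bigr => i _; rewrite muX// epsN.
have [S [S0 ThetaS]] : exists S : R, 0 <= S /\ forall a, Theta a ->
    [/\ `|a.1| <= S, `|a.2.1| <= S & `|a.2.2| <= S].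
  have [S [_ HS]] := compact_bounded cT.
  exists (`|S| + 1); split => [|a /HS aS]; first exact: addr_ge0.
  have {}aS := aS _ (le_lt_trans (ler_norm S) (ltr_pwDr ltr01 (lexx _))).
  by move: aS; rewrite /= !prod_normE !ge_max => /andP[-> /andP[-> ->]].
(* A measurable set of full measure on which (A.1) and (A.2) hold pointwise; absolute values make
   the constants nonnegative. *)
have [good [mgood mugood goodP]] : exists good : set (Rd R d),
    [/\ measurable good, mu (~` good) = 0%E & forall x, good x ->
    [/\ `|x : 'rV[R]_d| <= `|C0|,
        (forall e e' : 'rV[R]_q, `|h x e - h x e'| <= `|L0| * `|e - e'|) &
        (forall e : 'rV[R]_q, `|h x e| <= `|B0|)]].
  have [N [mN N0 subN]] := aeh.
  pose ball0 := [set x : Rd R d | `|x : 'rV[R]_d| <= C0].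
  have mC : measurable ball0.
    rewrite -[X in measurable X]setTI; apply: measurable_fun_le => //.
    by apply: continuous_measurable_Rd => x; exact: norm_continuous.
  exists (~` N `&` ball0); split.
  - by apply: measurableI => //; exact: measurableC.
  - rewrite setCI setCK; apply/eqP; rewrite -measure_le0.
    apply: (@le_trans _ _ (mu N + mu (~` ball0))%E).
      by apply: measureU2 => //; exact: measurableC.
    by rewrite N0 add0e probability_setC// muC subee.
  - move=> x [/= Nx xC].
    have [hL hB] : (forall e e' : 'rV[R]_q, `|h x e - h x e'| <= L0 * `|e - e'|) /\
        (forall e : 'rV[R]_q, `|h x e| <= B0).
      by apply: contrapT => H; apply: Nx; exact: subN.
    split=> [|e1 e2|e1]; first exact: le_trans xC (ler_norm _).
      by apply: le_trans (hL _ _) _; rewrite ler_wpM2r// ler_norm.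
    exact: le_trans (hB _) (ler_norm _).
set C := `|C0| in goodP; set L := `|L0| in goodP; set B := `|B0| in goodP.
have [C_ge0 L_ge0 B_ge0] : [/\ 0 <= C, 0 <= L & 0 <= B] by split; exact: normr_ge0.
(* Cutting [h] off outside [good] makes the bounds valid at every [x], as the net argument demands,
   and changes the regression functions only on a null set. *)
pose h' (x : 'rV[R]_d) e := h x e * \1_good (x : Rd R d).
have mh' e1 : measurable_fun [set: Rd R d] (fun x : Rd R d => h' x e1).
  by apply: measurable_funM; [exact: mh|exact: measurable_indic].
have h'E G x : regfun h' G x = regfun h G x * \1_good (x : Rd R d).
  by rewrite /regfun mulr_suml; apply: eq_bigr => a _; rewrite mulrA.
have h'good G (x : Rd R d) : good x -> regfun h' G x = regfun h G x.
  by move=> gx; rewrite h'E indicE mem_set// mulr1.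
have h'bad G (x : Rd R d) : ~ good x -> regfun h' G x = 0.
  by move=> gx; rewrite h'E indicE memNset// mulr0.
have regB G (x : Rd R d) : (size G <= k)%N -> `|regfun h' G x| <= k%:R * B.
  move=> Gk; have [gx|gx] := pselect (good x); last first.
    by rewrite h'bad// normr0 mulr_ge0.
  have [_ _ hB] := goodP _ gx; rewrite h'good//.
  by apply: le_trans (regfun_bounded _ hB) _; rewrite ler_wpM2r// ler_nat.
(* [D] is the parameter dimension, [n ^ E] bounds the size of the net, and a parameter mesh
   [1 / (Lam * n)] moves regression functions by at most [1 / n]. *)
pose D := (1 + (d + q))%N; pose E := ((2 * D + 1) * k)%N.
pose Lam := k%:R * ((d%:R * C + 1) * B + L) + 1.
have Lam0 : 0 < Lam by rewrite ltr_wpDl// mulr_ge0// addr_ge0// mulr_ge0// addr_ge0// mulr_ge0.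
pose K := 2 * (k%:R * B).
pose c := 8 * nu + K ^+ 2.
have c0 : 0 < c by rewrite ltr_wpDr ?sqr_ge0// mulr_gt0.
(* This value makes the noise part of the failure probability exactly [e / 2]. *)
pose Cn := 4 * expR (nu / 2) / e.
have Cn0 : 0 < Cn by rewrite divr_gt0// mulr_gt0 ?expR_gt0.
pose b := (2 * K + 2 * Cn) / (4 * nu).
(* With [t = (E + 1) * c * ln n] below, the bound [2 * t + 2 / n] is at most [M2 * ln n] as soon as
   [ln n >= 1]. *)
pose M2 := 2 * ((E%:R + 1) * c) + 2.
have M20 : 0 < M2.
  by rewrite /M2 ltr_wpDl// mulr_ge0// mulr_ge0 ?(ltW c0)// addr_ge0.
exists (Num.sqrt M2); split; first by rewrite sqrtr_gt0.
pose a0 := 2 * S * Lam.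
have a00 : 0 <= a0 by rewrite mulr_ge0 ?(ltW Lam0)// mulr_ge0.
(* The summands serve in turn [net_card_le], the bound [expR b / n <= e / 2], and [ln n >= 1]. *)
pose y := a0 + 2 + 2 * expR b / e + expR 1.
exists (Num.truncn y).+1 => n Nn.
have yn : y <= n%:R.
  by apply: le_trans (ltW (truncnS_gt y)) _; rewrite ler_nat.
have y1 : 0 < 2 * expR b / e by rewrite divr_gt0// mulr_gt0 ?expR_gt0.
have y2 : 0 < expR 1 :> R by exact: expR_gt0.
have n0 : (0 < n)%N by exact: leq_trans Nn.
have nR0 : 0 < n%:R :> R by rewrite ltr0n.
have ln1 : 1 <= ln n%:R :> R.
  by rewrite -[leLHS]expRK ler_ln ?posrE//; move: yn; rewrite /y; lra.
pose r := (Lam * n%:R)^-1.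
have r0 : 0 < r by rewrite invr_gt0 mulr_gt0.
pose s := (Num.truncn (a0 * n%:R)).+1.
have Ss : (Num.truncn (2 * S / r) < s)%N.
  by rewrite /r invrK mulrA.
pose net := lists_upto (@atom_net R d q S r s) k.
pose t := (E%:R + 1) * c * ln n%:R.
have netk G : G \in net -> (size G <= k)%N by exact: lists_upto_size.
have Gsk' := ltnW Gsk.
pose g G (x : Rd R d) := regfun h' G x - regfun h' Gs x.
have mg G : measurable_fun setT (g G).
  by apply: measurable_funB; exact: measurable_regfun.
have gK G x : (size G <= k)%N -> `|g G x| <= K.
  move=> Gk; apply: le_trans (ler_normB _ _) _.
  by rewrite /K mulr_natl mulr2n lerD// regB.
have [A [mA PA HA]] := net_excess_bound nu0 mX meps (XeN n) epsN t n0 Cn0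
  (fun G (_ : G \in net) => mg G) (fun G x (Gn : G \in net) => gK G x (netk G Gn)).
(* On this null event some sample point leaves [good]; off it the sample does not distinguish [h]
   from [h']. *)
pose bad := \big[setU/set0]_(i <- iota 0 n) (X i @^-1` (~` good)).
have mXbad i : measurable (X i @^-1` (~` good)).
  by rewrite -[X in measurable X]setTI; apply: mX => //; exact: measurableC.
have mbad : measurable bad by exact: bigsetU_measurable.
exists (bad `|` A); split; first exact: measurableU.
split; last first.
  apply: (@le_trans _ _ (P bad + P A)%E); first exact: measureU2.
  have -> : P bad = 0%E.
    apply/eqP; rewrite -measure_le0.
    have := @measure_bigsetU_le_const _ _ _ P _ (iota 0 n)
      (fun i => X i @^-1` (~` good)) 0.
    rewrite mulr0; apply => // i _; rewrite muX ?mugood//.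
    exact: measurableC.
  rewrite add0e; apply: le_trans PA _; rewrite lee_fin.
  have -> : 2 * expR (nu / 2) / Cn = e / 2.
    by rewrite /Cn; field; rewrite !gt_eqF// expR_gt0.
  have sizenet : (size net)%:R <= n%:R ^+ E :> R.
    rewrite -natrX ler_nat; apply: leq_trans (size_lists_upto _ _) _.
    rewrite size_atom_net; apply: net_card_le => //.
    by move: yn; rewrite /y; lra.
  (* The power [n ^ (E + 1)] beats the [n ^ E] net elements by one factor [n], leaving
     [expR b / n]. *)
  have -> : expR (- t / (8 * nu + K ^+ 2)) = (n%:R ^+ E.+1)^-1.
    rewrite (_ : _ / _ = - (E.+1%:R * ln n%:R)).
      by rewrite expRN expRM_natl lnK ?posrE.
    by rewrite /t -/c -natr1; field; rewrite gt_eqF.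
  have : (size net)%:R * (expR b * (n%:R ^+ E.+1)^-1) <= expR b / n%:R.
    rewrite exprS invfM mulrCA ler_wpM2l ?expR_ge0// mulrCA ler_piMr ?invr_ge0//.
    by rewrite ler_pdivrMr ?mul1r// exprn_gt0.
  have : expR b / n%:R <= e / 2.
    rewrite ler_pdivrMr// [leRHS]mulrC mulrA ler_pdivlMr// [leLHS]mulrC.
    rewrite -ler_pdivrMr//; move: yn; rewrite /y.
    by have := a00; lra.
  by rewrite -/b; lra.
move=> w Nw; apply: contrapT => /not_orP[nbad nA].
have Xgood i : (i < n)%N -> good (X i w).
  move=> ni; apply: contrapT => ngood; apply: nbad.
  by rewrite /bad (big_rem i) ?mem_iota//=; left.
have [[/andP[_ Ghk] GhT] GhLS] := LSE n w.
have lip G G' : (size G <= k)%N -> (exists2 f, G' = map f G &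
      forall a, a \in G -> atom_close r a (f a)) ->
    forall x : Rd R d, `|g G x - g G' x| <= n%:R^-1.
  move=> Gk [f -> fP] x.
  have -> : g G x - g (map f G) x = regfun h' G x - regfun h' (map f G) x.
    by rewrite /g; ring.
  have [gx|gx] := pselect (good x); last first.
    by rewrite !h'bad// subrr normr0 invr_ge0.
  have [xC hL hB] := goodP _ gx; rewrite !h'good//.
  apply: le_trans (regfun_close xC hB hL L_ge0 fP) _.
  have -> : n%:R^-1 = Lam * r.
    by rewrite /r; field; rewrite !gt_eqF.
  rewrite mulrA ler_wpM2r ?(ltW r0)// /Lam ler_wpDr// ler_wpM2r ?ler_nat//.
  by rewrite addr_ge0// mulr_ge0// addr_ge0// mulr_ge0.
(* Rounding to the net is chosen atom by atom, so the rounded estimator is a [map]; outside [Theta]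
   the value is arbitrary. *)
have /choice[rnd rndP] : forall a, exists a', Theta a ->
    a' \in @atom_net R d q S r s /\ atom_close r a a'.
  move=> a; have [Ta|nTa] := pselect (Theta a); last by exists a.
  have [S1 S2 S3] := ThetaS _ Ta.
  by have [a' ? ?] := atom_net_close r0 S1 S2 S3 Ss; exists a'.
have netGh : map rnd (Ghat n w) \in net.
  apply: mem_lists_upto; first by rewrite size_map.
  by move=> _ /mapP[a /GhT Ta ->]; have [] := rndP _ Ta.
(* Comparing the criterion at the estimator with its value at [Gs], where the residuals are the
   [eps i w]; the squared noise cancels. *)
have basic : \sum_(i < n) g (Ghat n w) (X i w) ^+ 2 <=
    2 * \sum_(i < n) eps i w * g (Ghat n w) (X i w).
  have GsGk : in_Gk Theta k Gs by split => //; rewrite Gs0 Gsk'.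
  have := GhLS _ GsGk; rewrite -subr_ge0 -sumrB => H.
  rewrite -subr_ge0 mulr_sumr -sumrB; apply: le_trans H _.
  rewrite le_eqVlt; apply/orP; left; apply/eqP; apply: eq_bigr => i _.
  by rewrite /g !h'good//; [ring|exact: Xgood..].
have := HA w nA _ (mg (Ghat n w)) (fun x => gK _ x Ghk) _ basic.
have netc : exists2 G, G \in net & forall x : Rd R d,
    `|g (Ghat n w) x - g G x| <= n%:R^-1.
  exists (map rnd (Ghat n w)) => //; apply: lip => //.
  by exists rnd => // a /GhT Ta; have [] := rndP _ Ta.
move=> /(_ netc) vle; move: Nw => /=; apply/negP; rewrite -leNgt.
apply: (Lnorm2_le (f := g (Ghat n w))).
- by rewrite mulr_ge0// sqrtr_ge0.
- exact: mg.
- by apply: measurable_funB; exact: measurable_regfun.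
- exists (~` good); split; [exact: measurableC|exact: mugood|].
  move=> x /= Hx gx; apply: Hx; rewrite /g !h'good//.
- have fin := integral_sqr_fin_num mu (mg (Ghat n w)) (fun x => gK _ x Ghk).
  rewrite -(fineK fin) lee_fin exprMn !sqr_sqrtr ?(ltW M20)//; last first.
    by rewrite divr_ge0// (le_trans _ ln1).
  rewrite mulrA ler_pdivlMr// mulrC; apply: le_trans vle _.
  have n1 : n%:R^-1 <= ln n%:R :> R.
    by rewrite (le_trans _ ln1)// invf_le1// ler1n.
  by rewrite /M2 /t; move: n1; lra.
Qed.
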